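(* There exist absolute constants $C>0$ and $A>0$ such that the following holds. Let $0\le\lambda_1<\lambda_2<\cdots$ be a sequence of real numbers, let $f(n)\ge0$, $n\ge1$, be real numbers with $\sum_{n\ge1}f(n)<\infty$, and put $F(x)=\sum_{n\ge1}f(n)e^{2\pi i\lambda_nx}$ for $x\in\mathbb{R}$. Then for any integer $M\ge1$, any set $\mathcal{M}\subseteq\mathbb{N}=\{1,2,\dots\}$ of cardinality $M$ and any real $T>Y\ge1$, there is a real number $\Sigma$ with $$\left|\Sigma-2C\sum_{m\in\mathcal{M}}f(m)\right|\le A\,\frac{2^M\,Y\log T}{T}\sum_{n\ge1}f(n)$$ such that $$\max_{x\in[Y,T]}\Re(F(x))\ge\Sigma,$$ and such that, if $\Sigma>0$, then for every $0<V\le\Sigma$, $$\operatorname{meas}\left\{x\in[Y,T]:\Re(F(x))\ge V\right\}\;\ge\;\frac{(\Sigma-V)\,T}{2^M\,\log T\,\max_{x\in[Y,T]}|F(x)|}.$$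
   Context: ''Absolute'' means that the constants $C$ and $A$ do not depend on any of the data $(\lambda_n)$, $f$, $M$, $\mathcal{M}$, $Y$, $T$. $\Re$ denotes the real part, $\log$ the natural logarithm, and $\operatorname{meas}$ Lebesgue measure on $\mathbb{R}$.
   Formalization: The formal theorem additionally assumes T ≥ 2; for T close to 1 the claim fails, since log T → 0 forces Σ near 2C∑f(m) > 0 while, e.g., F(x)=e^{πix} with Y=1 has negative real part on [1,T]. *)

(* Defs.v *)
From mathcomp Require Import all_boot all_order all_algebra.
From mathcomp Require Import complex finmap.
From mathcomp Require Import all_classical all_reals all_analysis.

Set Implicit Arguments.
Unset Strict Implicit.
Unset Printing Implicit Defensive.

Import Order.TTheory GRing.Theory Num.Theory.
Import numFieldNormedType.Exports.

Local Open Scope classical_set_scope.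
Local Open Scope ring_scope.
Local Open Scope complex_scope.

(* Sequences (lambda_n), (f(n)) are functions on nat of which only the values
   at n >= 1 are used. *)

Definition sum_from1 (R : realType) (f : nat -> R) : R :=
  limn (fun N => \sum_(1 <= n < N) f n).

Definition expi (R : realType) (t : R) : R[i] := cos t +i* sin t.

(* The limit is taken in R[i]; the regular module R[i]^o is the alias of R[i]
   that carries the topology induced by the complex norm. *)
Definition expsum (R : realType) (lambda f : nat -> R) (x : R) : R[i] :=
  limn (fun N =>
    (\sum_(1 <= n < N) (f n)%:C * expi (2 * pi * lambda n * x)) : R[i]^o).

(* `|z| lives in R[i], with zero imaginary part. *)
Definition cabs (R : realType) (z : R[i]) : R := complex.Re `|z|.

Definition is_max (R : realType) (g : R -> R) (D : set R) (m : R) : Prop :=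
  (g @` D `&` ubound (g @` D)) m.

(* Main.v *)
Require Import Defs.
From mathcomp Require Import all_boot all_order all_algebra.
From mathcomp Require Import complex finmap.
From mathcomp Require Import all_classical all_reals all_analysis.
From mathcomp Require Import ring lra.

Import Order.TTheory GRing.Theory Num.Theory.
Import numFieldNormedType.Exports.

Local Open Scope classical_set_scope.
Local Open Scope ring_scope.

(** The proof is the resonance method: average the real part of F against a
    nonnegative weight that favours the frequencies in the chosen set A.

    The weight on [0, T] is R(x) (1 - x/T), where R is the Riesz product
    of the factors 1 + cos(2 pi lambda_m x), m in A, so that 0 <= R <= 2^M.
    Everything rests on one positivity fact: the tent 1 - x/T has nonnegative
    cosine transform on [0, T] ([Rintegral_cos_tent_ge0]), hence it integrates
    to something nonnegative against any member of the cone of nonnegative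
    combinations of cosines ([Rintegral_cosine_cone_tent_ge0]).  This cone is
    closed under products, and it contains
    - R - 1, so the total mass N of the weight is at least T/2
      ([kernel_mass_ge]);
    - (cos(2 pi lambda_m x) - 1/2) R(x) for m in A, because
      (cos t - 1/2)(1 + cos t) = (cos t + cos 2t)/2
      ([cosine_cone_riesz_resonance]).  The comparison is with R and not
      with 1, so additive relations between the frequencies, which can make
      the mass of R large, do no harm.
    As f >= 0, the weighted average of Re F is at least s/2 with
    s = sum over A of f(m) ([cosine_cone_partial_sum]), which gives C = 1/4.

    If Re F <= c + h on [0, T], it follows that
    (s/2 - c) N <= 2^M int_0^T h ([Re_expsum_resonance]).  Write L for the sum
    of all f(n).  On [0, Y] only the trivial bound |Re F| <= L is used;
    this costs the term of order 2^M Y L in both applications: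
    - c = max Re F and h = 2L on [0, Y] bound the maximum from below
      ([le_max_Re_expsum]);
    - c = V and h = L on [0, Y] plus max |F| on the set where Re F >= V bound
      the measure of that set ([le_measure_Re_expsum]).
    The number Sigma is s/2 minus the full permitted error.  The error
    constant is chosen so large that Sigma > 0 forces T >= e^2; then log T >= 2 makes up
    for the loss in N >= T/2.

    The comparison with R is made for partial sums of F, which are finite
    combinations of cosines and approximate F uniformly
    ([partial_sum_near_Re_expsum]), so no series is integrated term by
    term. *)

(** * Nonnegative combinations of cosines *)

(** An inductive predicate rather than explicit coefficients: closure under
    products, continuity and nonnegative tent integrals then all follow by
    induction. *)
Inductive cosine_cone {R : realType} : (R -> R) -> Prop :=
| cosine_cone_cos a : cosine_cone (fun x => cos (a * x))
| cosine_coneD g h :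
    cosine_cone g -> cosine_cone h -> cosine_cone (fun x => g x + h x)
| cosine_coneZ c g :
    0 <= c -> cosine_cone g -> cosine_cone (fun x => c * g x).

Section CosineCone.
Context {R : realType}.
Implicit Types (g h : R -> R) (s : seq nat) (a f : nat -> R).

Lemma cosine_cone1 : cosine_cone (fun _ : R => 1).
Proof.
have := cosine_cone_cos (0 : R).
by under eq_fun do rewrite mul0r cos0.
Qed.

Lemma cosine_cone0 : cosine_cone (fun _ : R => 0).
Proof.
have := cosine_coneZ _ _ (lexx 0) cosine_cone1.
by under eq_fun do rewrite mul0r.
Qed.

Lemma cosine_cone_sum (I : eqType) (r : seq I) (g_ : I -> R -> R) :
  (forall i, i \in r -> cosine_cone (g_ i)) ->
  cosine_cone (fun x => \sum_(i <- r) g_ i x).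
Proof.
elim: r => [|i r IHr] hg.
  by under eq_fun do rewrite big_nil; exact: cosine_cone0.
under eq_fun do rewrite big_cons.
apply: cosine_coneD; first by apply: hg; rewrite mem_head.
by apply: IHr => k kr; apply: hg; rewrite inE kr orbT.
Qed.

Lemma cos_mul_cos (u v : R) : cos u * cos v = 2^-1 * (cos (u + v) + cos (u - v)).
Proof. by rewrite cosD cosB; field. Qed.

Lemma cosine_coneM g h :
  cosine_cone g -> cosine_cone h -> cosine_cone (fun x => g x * h x).
Proof.
move=> hg hh; elim: hg => [a|g1 g2 _ IH1 _ IH2|c g1 c0 _ IH1].
- elim: hh => [b|h1 h2 _ IH1 _ IH2|c h1 c0 _ IH1].
  + under eq_fun do rewrite cos_mul_cos -mulrDl -mulrBl.
    by apply: cosine_coneZ; [lra|apply: cosine_coneD; exact: cosine_cone_cos].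
  + by under eq_fun do rewrite mulrDr; exact: cosine_coneD.
  + by under eq_fun do rewrite mulrCA; exact: cosine_coneZ.
- by under eq_fun do rewrite mulrDl; exact: cosine_coneD.
- by under eq_fun do rewrite -mulrA; exact: cosine_coneZ.
Qed.

Lemma cosine_cone_continuous g : cosine_cone g -> continuous g.
Proof.
elim=> [a|g1 g2 _ IH1 _ IH2|c g1 c0 _ IH1] x.
- apply: (@continuous_comp _ _ _ (fun x => a * x) (@cos R)).
    exact: mulrl_continuous.
  exact: continuous_cos.
- by apply: cvgD; [exact: IH1|exact: IH2].
- by apply: cvgM; [exact: cvg_cst|exact: IH1].
Qed.

(** ** The Riesz product *)

Definition riesz_product a s (x : R) := \prod_(m <- s) (1 + cos (a m * x)).

Lemma riesz_product_ge0 a s x : 0 <= riesz_product a s x.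
Proof.
apply: prodr_ge0 => m _; by rewrite -lerBlDl sub0r cos_geN1.
Qed.

Lemma riesz_product_le a s x : riesz_product a s x <= 2 ^+ size s.
Proof.
rewrite /riesz_product; elim: s => [|m s IHs].
  by rewrite big_nil expr0.
rewrite big_cons exprS; apply: ler_pM => //; first exact: riesz_product_ge0.
by rewrite -[leRHS]/(1 + 1) lerD2l cos_le1.
Qed.

Lemma riesz_product_nil a : riesz_product a [::] = fun=> 1.
Proof. by apply/funext => x; rewrite /riesz_product big_nil. Qed.

Lemma riesz_product_cons a m s : riesz_product a (m :: s) =
  fun x => (1 + cos (a m * x)) * riesz_product a s x.
Proof. by apply/funext => x; rewrite /riesz_product big_cons. Qed.

Lemma cosine_cone_riesz a s : cosine_cone (riesz_product a s).
Proof.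
elim: s => [|m s IHs].
  rewrite riesz_product_nil; exact: cosine_cone1.
rewrite riesz_product_cons; apply: cosine_coneM => //.
apply: cosine_coneD; [exact: cosine_cone1|exact: cosine_cone_cos].
Qed.

(** Expanding the product, the constant term is at least 1 and all other
    coefficients are nonnegative. *)
Lemma cosine_cone_riesz_sub1 a s :
  cosine_cone (fun x => riesz_product a s x - 1).
Proof.
elim: s => [|m s IHs].
  rewrite riesz_product_nil.
  by under eq_fun do rewrite subrr; exact: cosine_cone0.
have -> : (fun x => riesz_product a (m :: s) x - 1) =
    (fun x => (riesz_product a s x - 1) + cos (a m * x) * riesz_product a s x).
  by apply/funext => x; rewrite riesz_product_cons; ring.
apply: cosine_coneD => //; apply: cosine_coneM; first exact: cosine_cone_cos.
exact: cosine_cone_riesz.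
Qed.

(** The factor of index m absorbs the possibly negative constant:
    (cos t - 1/2)(1 + cos t) = (cos t + cos 2t)/2.  Thus cos(a_m x) has
    weighted average at least 1/2. *)
Lemma cosine_cone_riesz_resonance a s m : m \in s ->
  cosine_cone (fun x => (cos (a m * x) - 2^-1) * riesz_product a s x).
Proof.
move=> ms.
have -> : (fun x => (cos (a m * x) - 2^-1) * riesz_product a s x) =
    (fun x => (2^-1 * (cos (a m * x) + cos ((a m + a m) * x)))
              * riesz_product a (rem m s) x).
  apply/funext => x; rewrite /riesz_product (big_rem m)//= mulrA; congr (_ * _).
  rewrite [(a m + a m) * x]mulrDl cosD.
  have := cos2Dsin2 (a m * x); set c := cos _; set d := sin _ => cd.
  have -> : d * d = 1 - c ^+ 2 by rewrite -cd; ring.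
  by field.
apply: cosine_coneM; last exact: cosine_cone_riesz.
apply: cosine_coneZ; first lra.
by apply: cosine_coneD; exact: cosine_cone_cos.
Qed.

Lemma sum_mem_fset f (A : {fset nat}) (K : nat) :
  (forall m, m \in A -> (1 <= m)%N) -> (forall m, m \in A -> (m < K)%N) ->
  \sum_(1 <= n < K | n \in A) f n = \sum_(m <- A) f m.
Proof.
move=> A1 AK; rewrite -big_filter; apply/perm_big/uniq_perm.
- by rewrite filter_uniq// iota_uniq.
- exact: fset_uniq.
move=> n; rewrite mem_filter mem_index_iota; case nA: (n \in A) => //=.
by rewrite A1// AK.
Qed.

(** Frequencies in A contribute at least f(m)/2 by resonance, the others at
    least 0 since their product with the Riesz product is in the cone. *)
Lemma cosine_cone_partial_sum a f (A : {fset nat}) (K : nat) :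
  (forall n, (1 <= n)%N -> 0 <= f n) ->
  (forall m, m \in A -> (1 <= m)%N) -> (forall m, m \in A -> (m < K)%N) ->
  cosine_cone (fun x =>
    (\sum_(1 <= n < K) f n * cos (a n * x) - 2^-1 * \sum_(m <- A) f m)
    * riesz_product a A x).
Proof.
move=> f0 A1 AK; rewrite -(sum_mem_fset f A K A1 AK).
have -> : (fun x => (\sum_(1 <= n < K) f n * cos (a n * x)
      - 2^-1 * \sum_(1 <= n < K | n \in A) f n) * riesz_product a A x) =
   (fun x => \sum_(1 <= n < K)
      f n * ((cos (a n * x) - (if n \in A then 2^-1 else 0))
             * riesz_product a A x)).
  apply/funext => x; rewrite [X in _ - _ * X]big_mkcond /=.
  rewrite mulr_sumr -sumrB mulr_suml.
  by apply: eq_bigr => n _; case: ifP => _; ring.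
apply: cosine_cone_sum => n; rewrite mem_index_iota => /andP[n1 _].
apply: cosine_coneZ; first exact: f0.
case: ifPn => nA; first exact: cosine_cone_riesz_resonance.
under eq_fun do rewrite subr0.
apply: cosine_coneM; [exact: cosine_cone_cos|exact: cosine_cone_riesz].
Qed.

End CosineCone.

(** * Integrals against the tent 1 - x/T *)

Section TentIntegral.
Context {R : realType}.
Notation mu := lebesgue_measure.

Lemma Rintegral_is_derive (F f : R -> R) (a b : R) : a < b -> continuous f ->
  (forall x, is_derive x (1 : R) F (f x)) ->
  \int[mu]_(x in `[a, b]) f x = F b - F a.
Proof.
move=> ab cf dF.
have cF : continuous F.
  by move=> x; apply/differentiable_continuous/derivable1_diffP; exact: ex_derive.
rewrite /Rintegral (@continuous_FTC2 _ f F)//.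
- exact: continuous_subspaceT.
- split; first by move=> x _; exact: ex_derive.
  + by apply: cvg_at_right_filter; exact: cF.
  + by apply: cvg_at_left_filter; exact: cF.
- by move=> x _; rewrite derive1E derive_val.
Qed.

Lemma tent_continuous (T : R) : continuous (fun x : R => 1 - x / T).
Proof.
move=> x; apply: cvgB; first exact: cvg_cst.
by apply: cvgM; [exact: cvg_id|exact: cvg_cst].
Qed.

Lemma Rintegral_tent (T : R) : 0 < T ->
  \int[mu]_(x in `[0, T]) (1 - x / T) = T / 2.
Proof.
move=> T0.
have dF (x : R) : is_derive x (1 : R) (fun x => x - x * x * (2 * T)^-1) (1 - x / T).
  apply: is_derive_eq.
  by rewrite /GRing.scale/=; field; rewrite gt_eqF.
rewrite (Rintegral_is_derive _ _ _ _ T0 (tent_continuous T) dF).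
by field; rewrite gt_eqF.
Qed.

(** The value is (1 - cos (a T)) / (a^2 T), a half-line form of the
    nonnegativity of the Fejer kernel. *)
Lemma Rintegral_cos_tent_ge0 (a T : R) : 0 < T ->
  0 <= \int[mu]_(x in `[0, T]) (cos (a * x) * (1 - x / T)).
Proof.
move=> T0; have [->|a0] := eqVneq a 0.
  apply: Rintegral_ge0 => x /=; rewrite in_itv/= => /andP[_ xT].
  by rewrite mul0r cos0 mul1r subr_ge0 ler_pdivrMr// mul1r.
have dax (x : R) : is_derive x (1 : R) (fun y => a * y) a.
  by apply: is_derive_eq; rewrite /GRing.scale/=; ring.
have dsin (x : R) : is_derive x (1 : R) (fun y => sin (a * y)) (a * cos (a * x)).
  by rewrite mulrC; exact: (is_derive1_comp (is_derive_sin _) (dax x)).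
have dcos (x : R) : is_derive x (1 : R) (fun y => cos (a * y)) (- a * sin (a * x)).
  by rewrite mulNr -mulrN mulrC; exact: (is_derive1_comp (is_derive_cos _) (dax x)).
pose F (x : R) := (1 - x / T) * sin (a * x) * a^-1 - cos (a * x) * (a ^+ 2 * T)^-1.
have dF (x : R) : is_derive x (1 : R) F (cos (a * x) * (1 - x / T)).
  apply: is_derive_eq.
  by rewrite /GRing.scale/=; field; rewrite a0 gt_eqF.
rewrite (Rintegral_is_derive _ _ _ _ T0 _ dF).
  rewrite /F !mulr0 !mul0r cos0 divff ?gt_eqF// subrr !mul0r sin0 mulr0 mul0r.
  rewrite !sub0r opprK addrC mul1r -[X in X - _]mul1r -mulrBl.
  rewrite mulr_ge0 ?subr_ge0 ?cos_le1// invr_ge0 mulr_ge0 ?sqr_ge0//.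
  exact: ltW.
move=> x; apply: cvgM; last exact: tent_continuous.
by apply: cosine_cone_continuous; exact: cosine_cone_cos.
Qed.

Lemma integrable_continuous_itv (f : R -> R) (a b : R) :
  continuous f -> mu.-integrable `[a, b] (EFin \o f).
Proof.
move=> cf; apply: continuous_compact_integrable; first exact: segment_compact.
exact: continuous_subspaceT.
Qed.

Lemma integrable_cosine_cone_tent (g : R -> R) (T : R) : cosine_cone g ->
  mu.-integrable `[0, T] (EFin \o (fun x => g x * (1 - x / T))).
Proof.
move=> hg; apply: integrable_continuous_itv => x.
by apply: cvgM; [exact: cosine_cone_continuous|exact: tent_continuous].
Qed.

Lemma Rintegral_cosine_cone_tent_ge0 (g : R -> R) (T : R) : 0 < T ->
  cosine_cone g -> 0 <= \int[mu]_(x in `[0, T]) (g x * (1 - x / T)).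
Proof.
move=> T0; elim=> [a|g1 g2 h1 IH1 h2 IH2|c g1 c0 h1 IH1].
- exact: Rintegral_cos_tent_ge0.
- under eq_Rintegral do rewrite mulrDl.
  by rewrite RintegralD ?addr_ge0//; exact: integrable_cosine_cone_tent.
- under eq_Rintegral do rewrite -mulrA.
  by rewrite RintegralZl ?mulr_ge0//; exact: integrable_cosine_cone_tent.
Qed.

Lemma integrable_indic_itv_sub (D : set R) (a b : R) : measurable D ->
  mu.-integrable `[a, b] (EFin \o (\1_D : R -> R)).
Proof.
move=> mD; apply: measurable_bounded_integrable => //=.
- rewrite lebesgue_measure_itv/=.
  by case: ifPn => // _; rewrite -EFinB ltry.
- exists 1; split; first exact: num_real.
  move=> M M1 x _ /=; rewrite indicE ger0_norm; last by case: (_ \in _).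
  by apply: le_trans (ltW M1); case: (_ \in _).
Qed.

Lemma Rintegral_indic_itv (D : set R) (a b : R) : measurable D ->
  D `<=` `[a, b] -> \int[mu]_(x in `[a, b]) (\1_D x) = fine (mu D).
Proof.
by move=> mD Dab; rewrite /Rintegral integral_indic// setIidl.
Qed.

Lemma Rintegral_kernel_ge (r : R -> R) (T : R) : 0 < T -> cosine_cone r ->
  cosine_cone (fun x => r x - 1) ->
  T / 2 <= \int[mu]_(x in `[0, T]) (r x * (1 - x / T)).
Proof.
move=> T0 hr hr1; rewrite -(Rintegral_tent _ T0) -subr_ge0 -RintegralB//.
- have := Rintegral_cosine_cone_tent_ge0 _ _ T0 hr1.
  by under eq_Rintegral do rewrite mulrBl mul1r.
- exact: integrable_cosine_cone_tent.
- by apply: integrable_continuous_itv; exact: tent_continuous.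
Qed.

(** Here r is the resonating weight and s a lower bound for the weighted
    average of g in the sense of the cone.  Integrating
    (g - s) r <= (c - s) r + B h against the tent, which lies in [0, 1], turns
    an upper bound for g into a comparison of s with c. *)
Lemma resonance_majorant (g r h : R -> R) (s c B T : R) : 0 < T ->
  cosine_cone (fun x => (g x - s) * r x) -> cosine_cone r ->
  (forall x, 0 <= r x <= B) ->
  mu.-integrable `[0, T] (EFin \o h) ->
  (forall x, x \in `[0, T] -> 0 <= h x) ->
  (forall x, x \in `[0, T] -> g x <= c + h x) ->
  (s - c) * \int[mu]_(x in `[0, T]) (r x * (1 - x / T))
    <= B * \int[mu]_(x in `[0, T]) (h x).
Proof.
move=> T0 hgr hr rB ih h0 gh.
have ir := integrable_cosine_cone_tent r T hr.
have isr : mu.-integrable `[0, T]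
    (EFin \o (fun x => (s - c) * (r x * (1 - x / T)))).
  exact: (integrableZl _ _ ir).
have iBh : mu.-integrable `[0, T] (EFin \o (fun x => B * h x)).
  exact: (integrableZl _ _ ih).
rewrite -RintegralZl// -[leRHS]RintegralZl// -subr_ge0 -RintegralB//.
apply: le_trans (Rintegral_cosine_cone_tent_ge0 _ _ T0 hgr) _.
apply: le_Rintegral => //; first exact: integrable_cosine_cone_tent.
  exact: (integrableB _ iBh isr).
move=> x xT; have /andP[r0 rB'] := rB x; have := h0 x xT; have := gh x xT.
move: xT; rewrite /= in_itv/= => /andP[x0 xT] gx hx.
have t0 : 0 <= 1 - x / T by rewrite subr_ge0 ler_pdivrMr// mul1r.
have t1 : 1 - x / T <= 1 by rewrite gerBl divr_ge0// ltW.
rewrite -subr_ge0.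
have w0 : 0 <= r x * (1 - x / T) by rewrite mulr_ge0.
have w1 : r x * (1 - x / T) <= B.
  by apply: le_trans rB'; rewrite ler_piMr.
have : (g x - c) * (r x * (1 - x / T)) <= h x * B.
  apply: (@le_trans _ _ (h x * (r x * (1 - x / T)))).
    by rewrite ler_wpM2r// lerBlDl.
  by rewrite ler_wpM2l.
lra.
Qed.
End TentIntegral.

(** * Series dominated by a convergent one *)

Section DominatedSeries.
Context {R : realType}.
Variable f : nat -> R.
Hypothesis f0 : forall n, (1 <= n)%N -> 0 <= f n.
Hypothesis cf : cvgn (fun N => \sum_(1 <= n < N) f n).

Lemma partial_sum_le_sum_from1 (N : nat) :
  \sum_(1 <= n < N) f n <= sum_from1 f.
Proof.
apply: (@nondecreasing_cvgn_le _ (fun N => \sum_(1 <= n < N) f n)) => // p q pq.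
have [p1|p1] := leqP p 1.
  rewrite [leLHS]big_geq// big_nat_cond; apply: sumr_ge0 => n.
  by rewrite andbT => /andP[/f0].
rewrite (big_cat_nat (ltnW p1) pq)/= lerDl big_nat_cond; apply: sumr_ge0 => n.
by rewrite andbT => /andP[pn _]; exact/f0/(leq_trans (ltnW p1)).
Qed.

Lemma sum_from1_ge0 : 0 <= sum_from1 f.
Proof. by have := partial_sum_le_sum_from1 0; rewrite big_geq. Qed.

Lemma partial_sum_tail (u : nat -> R) (N K : nat) :
  (forall n, (1 <= n)%N -> `|u n| <= f n) -> (1 <= N <= K)%N ->
  `|\sum_(1 <= n < K) u n - \sum_(1 <= n < N) u n|
    <= sum_from1 f - \sum_(1 <= n < N) f n.
Proof.
move=> uf /andP[N1 NK].
apply: (@le_trans _ _ (\sum_(1 <= n < K) f n - \sum_(1 <= n < N) f n)); last first.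
  by rewrite lerD2r partial_sum_le_sum_from1.
rewrite !(big_cat_nat N1 NK)/= ![_ + _ - _]addrAC !subrr !add0r.
apply: le_trans (ler_norm_sum _ _ _) _.
by apply: ler_sum_nat => n /andP[/(leq_trans N1)/uf].
Qed.

Lemma partial_sum_tail_small (e : R) : 0 < e ->
  \forall N \near \oo, sum_from1 f - \sum_(1 <= n < N) f n < e.
Proof.
move=> e0; have [N0 _ HN] := cvgr_dist_lt _ _ cf _ e0.
exists N0 => // N /HN; rewrite ger0_norm// subr_ge0.
exact: partial_sum_le_sum_from1.
Qed.

Lemma dominated_is_cvg (u : nat -> R) :
  (forall n, (1 <= n)%N -> `|u n| <= f n) ->
  cvgn (fun N => \sum_(1 <= n < N) u n).
Proof.
move=> uf; apply: cauchy_cvg; apply: cauchy_exP => e e0.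
have [N _ HN] := partial_sum_tail_small _ e0.
have N1 : (1 <= N.+1)%N by [].
exists (\sum_(1 <= n < N.+1) u n).
exists N.+1 => // K /= NK; rewrite /ball/= distrC.
apply: le_lt_trans (HN N.+1 (leqnSn N)).
by apply: partial_sum_tail => //; rewrite NK.
Qed.

(** The bound does not depend on u: this uniformity gives both the continuity
    of F and its uniform approximation by partial sums. *)
Lemma dominated_tail (u : nat -> R) (N : nat) :
  (forall n, (1 <= n)%N -> `|u n| <= f n) -> (1 <= N)%N ->
  `|sum_from1 u - \sum_(1 <= n < N) u n| <= sum_from1 f - \sum_(1 <= n < N) f n.
Proof.
move=> uf N1; have cu := dominated_is_cvg _ uf.
have tail : \forall K \near \oo,
    `|\sum_(1 <= n < K) u n - \sum_(1 <= n < N) u n|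
    <= sum_from1 f - \sum_(1 <= n < N) f n.
  by exists N => // K /= NK; apply: partial_sum_tail => //; rewrite N1.
rewrite ler_distl; apply/andP; split.
  apply: limr_ge => //; apply: filterS tail => K.
  by rewrite ler_distl => /andP[].
apply: limr_le => //; apply: filterS tail => K.
by rewrite ler_distl => /andP[].
Qed.

Lemma dominated_continuous (u : R -> nat -> R) :
  (forall x n, (1 <= n)%N -> `|u x n| <= f n) ->
  (forall n, continuous (u^~ n)) ->
  continuous (fun x => sum_from1 (u x)).
Proof.
move=> uf cu x; apply/cvgrPdist_lt => e e0.
have e3 : 0 < e / 3 by rewrite divr_gt0.
have [N _ HN] := partial_sum_tail_small _ e3.
pose s y := \sum_(1 <= n < N.+1) u y n.
have tail y : `|sum_from1 (u y) - s y| < e / 3.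
  by apply: le_lt_trans (HN N.+1 (leqnSn N)); exact: (dominated_tail _ _ (uf y)).
have cs : continuous s.
  apply: continuous_big => [|n _]; last exact: cu.
  exact: add_continuous.
apply: filterS (cvgr_dist_lt _ _ (cs x) _ e3) => y sxy.
have := tail x; have := tail y; rewrite [X in X < _ -> _]distrC => ty tx.
rewrite [ltRHS](_ : _ = e / 3 + e / 3 + e / 3); last by field.
rewrite [X in `|X|](_ : _ = (sum_from1 (u x) - s x) + (s x - s y)
  + (s y - sum_from1 (u y))); last by ring.
apply: le_lt_trans (ler_normD _ _) _; apply: ltrD => //.
by apply: le_lt_trans (ler_normD _ _) _; exact: ltrD.
Qed.

End DominatedSeries.

(** * The exponential sum F *)

Section ExponentialSum.
Context {R : realType}.
Variables (lambda f : nat -> R).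
Hypothesis f0 : forall n, (1 <= n)%N -> 0 <= f n.
Hypothesis cf : cvgn (fun N => \sum_(1 <= n < N) f n).

Lemma partial_expsum (x : R) (N : nat) :
  (\sum_(1 <= n < N) (f n)%:C * expi (2 * pi * lambda n * x))%C =
  ((\sum_(1 <= n < N) f n * cos (2 * pi * lambda n * x))
   +i* (\sum_(1 <= n < N) f n * sin (2 * pi * lambda n * x)))%C.
Proof.
elim: (index_iota 1 N) => [|n r IHr]; first by rewrite !big_nil.
rewrite !big_cons IHr.
by rewrite /expi; simpc.
Qed.

Lemma normc_le_add (a b : R) : (`|a +i* b|)%C <= (`|a| + `|b|)%:C%C.
Proof.
rewrite normc_def lecR /= -[leRHS]ger0_norm ?addr_ge0// -sqrtr_sqr.
apply: ler_wsqrtr; rewrite sqrrD !real_normK ?num_real// lerD2r lerDl.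
by rewrite mulrn_wge0// mulr_ge0.
Qed.

Lemma norm_mul_cos_le (n : nat) (t : R) : (1 <= n)%N -> `|f n * cos t| <= f n.
Proof.
move=> n1; rewrite normrM (ger0_norm (f0 _ n1)) ler_piMr ?f0//.
by rewrite ler_norml cos_geN1 cos_le1.
Qed.

Lemma norm_mul_sin_le (n : nat) (t : R) : (1 <= n)%N -> `|f n * sin t| <= f n.
Proof.
move=> n1; rewrite normrM (ger0_norm (f0 _ n1)) ler_piMr ?f0//.
by rewrite ler_norml sin_geN1 sin_le1.
Qed.

(** The limit defining F is taken in the complex numbers; it is identified by
    bounding the complex distance by the tails of the real and imaginary
    parts. *)
Lemma expsumE (x : R) : expsum lambda f x =
  (sum_from1 (fun n => f n * cos (2 * pi * lambda n * x))
   +i* sum_from1 (fun n => f n * sin (2 * pi * lambda n * x)))%C.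
Proof.
set a := sum_from1 _; set b := sum_from1 _.
rewrite /expsum; apply: (@cvg_lim R[i]^o) => //.
under eq_fun do rewrite partial_expsum.
have tail := partial_sum_tail_small _ f0 cf.
apply/cvgrPdist_lt => e; rewrite ltcE /= => /andP[/eqP ei er].
have -> : e = ((complex.Re e)%:C)%C by apply/eqP; rewrite eq_complex /= ei !eqxx.
set r := complex.Re e in er *.
have r2 : 0 < r / 2 by rewrite divr_gt0.
have [N _ HN] := tail _ r2; exists N.+1 => // K /= NK.
have K1 : (1 <= K)%N by apply: leq_trans NK.
apply: le_lt_trans (normc_le_add _ _) _; rewrite ltcR [ltRHS]splitr.
have {}HN := HN K (ltnW NK).
apply: ltrD; apply: le_lt_trans HN; apply: dominated_tail => // n n1.
- exact: norm_mul_cos_le.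
- exact: norm_mul_sin_le.
Qed.

Lemma Re_expsum (x : R) : complex.Re (expsum lambda f x) =
  sum_from1 (fun n => f n * cos (2 * pi * lambda n * x)).
Proof. by rewrite expsumE. Qed.

Lemma cabsE (z : R[i]) :
  cabs z = Num.sqrt (complex.Re z ^+ 2 + complex.Im z ^+ 2).
Proof. by rewrite /cabs normc_def. Qed.

Lemma Re_le_cabs (z : R[i]) : complex.Re z <= cabs z.
Proof.
rewrite cabsE; apply: le_trans (ler_norm _) _.
by rewrite -sqrtr_sqr ler_wsqrtr// lerDl sqr_ge0.
Qed.

Lemma Re_expsum_continuous : continuous (fun x => complex.Re (expsum lambda f x)).
Proof.
under eq_fun do rewrite Re_expsum.
apply: (dominated_continuous _ f0 cf) => [x n|n x]; first exact: norm_mul_cos_le.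
apply: cvgM; first exact: cvg_cst.
exact/(cosine_cone_continuous _ (cosine_cone_cos _)).
Qed.

Lemma cabs_expsum_continuous : continuous (fun x => cabs (expsum lambda f x)).
Proof.
have cRe := Re_expsum_continuous.
have cIm : continuous (fun x => complex.Im (expsum lambda f x)).
  under eq_fun do rewrite expsumE /=.
  apply: (dominated_continuous _ f0 cf) => [x n|n x]; first exact: norm_mul_sin_le.
  apply: cvgM; first exact: cvg_cst.
  apply: (@continuous_comp _ _ _ (fun x => 2 * pi * lambda n * x) (@sin R)).
    exact: mulrl_continuous.
  exact: continuous_sin.
under eq_fun do rewrite cabsE !expr2.
move=> x; apply: (@continuous_comp _ _ _ (fun x => _) (@Num.sqrt R)).
  by apply: cvgD; apply: cvgM; [exact: cRe|exact: cRe|exact: cIm|exact: cIm].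
exact: sqrt_continuous.
Qed.

Lemma partial_sum_near_Re_expsum (e : R) : 0 < e ->
  \forall N \near \oo, forall x,
    `|complex.Re (expsum lambda f x)
      - \sum_(1 <= n < N) f n * cos (2 * pi * lambda n * x)| <= e.
Proof.
move=> e0; have [N _ HN] := partial_sum_tail_small _ f0 cf _ e0.
exists N.+1 => // K /= NK x; rewrite Re_expsum.
apply: le_trans (ltW (HN K (ltnW NK))).
apply: dominated_tail => //; last exact: leq_trans NK.
by move=> n; exact: norm_mul_cos_le.
Qed.

Lemma norm_Re_expsum_le (x : R) :
  `|complex.Re (expsum lambda f x)| <= sum_from1 f.
Proof.
rewrite Re_expsum; have := @dominated_tail _ _ f0 cf
  (fun n => f n * cos (2 * pi * lambda n * x)) 1%N.
by rewrite !big_geq// !subr0; apply => // n; exact: norm_mul_cos_le.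
Qed.

End ExponentialSum.

Lemma continuous_is_max (R : realType) (g : R -> R) (a b : R) : a <= b ->
  continuous g -> exists m, is_max g `[a, b] m.
Proof.
move=> ab cg.
have [c cab gc] := EVT_max ab (continuous_subspaceT cg).
exists (g c); split; first by exists c.
by move=> _ [y yab <-]; exact: gc.
Qed.

(** * The resonance inequality *)

Section Resonance.
Context {R : realType}.
Notation mu := lebesgue_measure.
Variables (lambda f : nat -> R) (A : {fset nat}).
Hypothesis f0 : forall n, (1 <= n)%N -> 0 <= f n.
Hypothesis cf : cvgn (fun N => \sum_(1 <= n < N) f n).
Hypothesis A1 : forall m, m \in A -> (1 <= m)%N.

Lemma fset_ltn_bigmax (m : nat) : m \in A -> (m < (\max_(k <- A) k).+1)%N.
Proof. by move=> mA; rewrite ltnS; exact: leq_bigmax_seq. Qed.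

Lemma sum_fset_le_sum_from1 : \sum_(m <- A) f m <= sum_from1 f.
Proof.
rewrite -(sum_mem_fset _ _ _ A1 fset_ltn_bigmax).
apply: le_trans (partial_sum_le_sum_from1 _ f0 cf _).
rewrite big_mkcond /=; apply: ler_sum_nat => n /andP[n1 _].
by case: ifP => // _; exact: f0.
Qed.

Definition kernel_mass (T : R) : R :=
  \int[mu]_(x in `[0, T])
    (riesz_product (fun n => 2 * pi * lambda n) A x * (1 - x / T)).

Lemma kernel_mass_ge (T : R) : 0 < T -> T / 2 <= kernel_mass T.
Proof.
move=> T0; apply: Rintegral_kernel_ge => //; first exact: cosine_cone_riesz.
exact: cosine_cone_riesz_sub1.
Qed.

(** A partial sum of Re F within e / N of it satisfies the hypothesis with
    c + e / N in place of c, where N is the mass of the weight; the resulting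
    inequality loses e, which is arbitrary. *)
Lemma Re_expsum_resonance (h : R -> R) (c T : R) : 0 < T ->
  mu.-integrable `[0, T] (EFin \o h) ->
  (forall x, x \in `[0, T] -> 0 <= h x) ->
  (forall x, x \in `[0, T] -> complex.Re (expsum lambda f x) <= c + h x) ->
  (2^-1 * (\sum_(m <- A) f m) - c) * kernel_mass T
    <= 2 ^+ #|` A| * \int[mu]_(x in `[0, T]) h x.
Proof.
move=> T0 ih h0 Fh.
have N0 : 0 < kernel_mass T.
  by apply: lt_le_trans (kernel_mass_ge _ T0); rewrite divr_gt0.
apply/ler_addgt0Pl => e e0.
have e1 : 0 < e / kernel_mass T by rewrite divr_gt0.
have [K0 _ HK] := partial_sum_near_Re_expsum lambda _ f0 cf _ e1.
(* K exceeds every index in A, so that the partial sum contains all of them. *)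
pose K := maxn K0 (\max_(k <- A) k).+1.
have AK m : m \in A -> (m < K)%N.
  by move=> mA; apply: leq_trans (fset_ltn_bigmax _ mA) (leq_maxr _ _).
pose a n := 2 * pi * lambda n.
pose g x := \sum_(1 <= n < K) f n * cos (a n * x).
have gh x : x \in `[0, T] -> g x <= (c + e / kernel_mass T) + h x.
  move=> /Fh Fx; have := HK K (leq_maxl _ _) x.
  rewrite ler_distl => /andP[+ _]; rewrite -/(g x) => gx; lra.
have r2 x : 0 <= riesz_product a A x <= 2 ^+ #|` A|.
  by rewrite riesz_product_ge0 riesz_product_le.
have := resonance_majorant _ _ _ _ _ _ _ T0
  (cosine_cone_partial_sum a f A K f0 A1 AK) (cosine_cone_riesz a A) r2 ih h0 gh.
rewrite -/(kernel_mass T) => major; rewrite -lerBlDl; apply: le_trans major.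
rewrite le_eqVlt; apply/orP; left; apply/eqP; by field; rewrite gt_eqF.
Qed.

(** On [0, Y] one has Re F <= L <= m + 2L, because m, a value of Re F, is at
    least -L; this form covers negative m too. *)
Lemma le_max_Re_expsum (Y T m : R) : 1 <= Y -> Y < T ->
  is_max (fun x => complex.Re (expsum lambda f x)) `[Y, T] m ->
  (2^-1 * (\sum_(k <- A) f k) - m) * kernel_mass T
    <= 2 ^+ #|` A| * (2 * sum_from1 f * Y).
Proof.
move=> Y1 YT [[x0 _ mE] mub].
have Y0 : 0 < Y by apply: lt_le_trans Y1.
have T0 : 0 < T by apply: lt_trans YT.
have L0 := sum_from1_ge0 _ f0 cf.
have sY : `[0, Y] `<=` `[0, T].
  by apply: subset_itvl; rewrite bnd_simp ltW.
have i1 := integrable_indic_itv_sub `[0, Y] 0 T (measurable_itv _).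
have -> : 2 * sum_from1 f * Y =
    \int[mu]_(x in `[0, T]) (2 * sum_from1 f * \1_(`[0, Y] : set R) x).
  rewrite RintegralZl// Rintegral_indic_itv//.
  by rewrite lebesgue_measure_itv/= lte_fin Y0 oppr0 addr0.
apply: Re_expsum_resonance => //.
- exact: (integrableZl _ _ i1).
- by move=> x _; rewrite !mulr_ge0.
move=> x; rewrite in_itv/= => /andP[x0' xT].
have := norm_Re_expsum_le lambda _ f0 cf x0; rewrite mE ler_norml => /andP[mL _].
have := norm_Re_expsum_le lambda _ f0 cf x; rewrite ler_norml => /andP[_ FL].
have [xY|Yx] := leP x Y.
  rewrite indicE mem_set/= ?in_itv/= ?x0'// mulr1; lra.
apply: le_trans (_ : m <= _).
  by apply: mub; exists x => //=; rewrite in_itv/= (ltW Yx).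
by rewrite lerDl !mulr_ge0.
Qed.

(** Re F is at most L on [0, Y], at most m on D and at most V elsewhere. *)
Lemma le_measure_Re_expsum (Y T V m : R) : 1 <= Y -> Y < T -> 0 < V -> 0 <= m ->
  is_max (fun x => cabs (expsum lambda f x)) `[Y, T] m ->
  let D := [set x : R | x \in `[Y, T] /\ V <= complex.Re (expsum lambda f x)] in
  exists2 d : R, mu D = d%:E &
  (2^-1 * (\sum_(k <- A) f k) - V) * kernel_mass T
    <= 2 ^+ #|` A| * (sum_from1 f * Y + m * d).
Proof.
move=> Y1 YT V0 m0 [_ mub] D.
have Y0 : 0 < Y by apply: lt_le_trans Y1.
have T0 : 0 < T by apply: lt_trans YT.
have L0 := sum_from1_ge0 _ f0 cf.
have mD : measurable D.
  rewrite (_ : D = `[Y, T] `&`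
      (fun x => complex.Re (expsum lambda f x)) @^-1` `[V, +oo[); last first.
    by apply/seteqP; split => x /=; rewrite !in_itv/= andbT.
  apply: measurableI => //; apply: measurable_realfun.closed_measurable.
  apply: preimage_closed => //; last exact: interval_closed.
  by move=> x _; exact: Re_expsum_continuous.
have sD : D `<=` `[0, T].
  by move=> x [+ _]; rewrite /= !in_itv/= => /andP[/(le_trans (ltW Y0))-> ->].
have sY : `[0, Y] `<=` `[0, T].
  by apply: subset_itvl; rewrite bnd_simp ltW.
have Dfin : mu D \is a fin_num.
  rewrite ge0_fin_numE//; apply: (@le_lt_trans _ _ (mu `[0, T])).
    by apply: le_measure => //; rewrite inE.
  by rewrite lebesgue_measure_itv/= lte_fin T0 -EFinB ltry.
exists (fine (mu D)); first by rewrite fineK.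
have iY := integrable_indic_itv_sub `[0, Y] 0 T (measurable_itv _).
have iD := integrable_indic_itv_sub D 0 T mD.
have iLY : mu.-integrable `[0, T]
    (EFin \o (fun x => sum_from1 f * \1_(`[0, Y] : set R) x)).
  exact: (integrableZl _ _ iY).
have imD : mu.-integrable `[0, T] (EFin \o (fun x => m * \1_D x)).
  exact: (integrableZl _ _ iD).
have -> : sum_from1 f * Y + m * fine (mu D) = \int[mu]_(x in `[0, T])
    (sum_from1 f * \1_(`[0, Y] : set R) x + m * \1_D x).
  rewrite RintegralD// !RintegralZl// !Rintegral_indic_itv//.
  by rewrite lebesgue_measure_itv/= lte_fin Y0 oppr0 addr0.
apply: Re_expsum_resonance => //.
- exact: (integrableD _ iLY imD).
- by move=> x _; rewrite addr_ge0// mulr_ge0.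
move=> x; rewrite in_itv/= => /andP[x0 xT].
have [xY|Yx] := leP x Y.
  have := norm_Re_expsum_le lambda _ f0 cf x; rewrite ler_norml => /andP[_ FL].
  rewrite indicE mem_set/= ?in_itv/= ?x0// mulr1.
  have : 0 <= m * \1_D x by rewrite mulr_ge0.
  lra.
have xYT : x \in `[Y, T] by rewrite in_itv/= (ltW Yx).
have [VF|FV] := leP V (complex.Re (expsum lambda f x)).
  have := le_trans (Re_le_cabs _) (mub _ (ex_intro2 _ _ x xYT erefl)).
  rewrite [\1_D x]indicE mem_set//= mulr1.
  have : 0 <= sum_from1 f * \1_(`[0, Y] : set R) x by rewrite mulr_ge0.
  lra.
apply: le_trans (ltW FV) _.
by rewrite lerDl addr_ge0// mulr_ge0.
Qed.

End Resonance.

(** * From the resonance inequality to the bounds *)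

Section Numerics.
Context {R : realType}.
Implicit Types (s L B Y T : R).

(** Dividing by N >= T/2 turns the loss 2 B L Y into 4 (B Y / T) L, whence
    the condition 4 <= a; here a stands for the error constant times
    log T, and B for 2^M. *)
Lemma max_ge_of_mass s m L B Y T N a :
  0 <= L -> 0 < B -> 0 < Y -> 0 < T -> T / 2 <= N -> 4 <= a ->
  (s - m) * N <= B * (2 * L * Y) -> s - a * (B * Y / T) * L <= m.
Proof.
move=> L0 B0 Y0 T0 TN a4 smN.
have E0 : 0 <= B * Y / T * L by rewrite mulr_ge0// divr_ge0 ?mulr_ge0 ?ltW.
have aE : 4 * (B * Y / T * L) <= a * (B * Y / T * L) by rewrite ler_wpM2r.
have [sm|sm] := leP s m; first by rewrite -[a * _ * _]mulrA; lra.
have : (s - m) * (T / 2) <= B * (2 * L * Y).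
  by apply: le_trans smN; rewrite ler_wpM2l// subr_ge0 ltW.
have -> : B * (2 * L * Y) = (4 * (B * Y / T * L)) * (T / 2).
  by field; rewrite gt_eqF.
rewrite ler_pM2r ?divr_gt0// => smE.
by rewrite -[a * _ * _]mulrA; lra.
Qed.

(** The loss from [0, Y] is now at most half of the error subtracted from s,
    so it disappears; the factor 2 from N >= T/2 is paid by l = log T >= 2. *)
Lemma measure_ge_of_mass s V m L B Y T N a l d :
  0 <= L -> 0 < B -> 0 < Y -> 0 < T -> T / 2 <= N -> 4 <= a -> 0 < m -> 2 <= l ->
  V <= s - a * (B * Y / T) * L ->
  (s - V) * N <= B * (L * Y + m * d) ->
  (s - a * (B * Y / T) * L - V) * T / (B * l * m) <= d.
Proof.
move=> L0 B0 Y0 T0 TN a4 m0 l2 Vs sVN.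
set E := a * (B * Y / T) * L in Vs *.
have q0 : 0 <= B * Y / T * L by rewrite mulr_ge0// divr_ge0 ?mulr_ge0 ?ltW.
have E0 : 4 * (B * Y / T * L) <= E by rewrite /E -[a * _ * _]mulrA ler_wpM2r.
have EN : 2 * (B * Y * L) <= E * N.
  have -> : 2 * (B * Y * L) = (4 * (B * Y / T * L)) * (T / 2).
    by field; rewrite gt_eqF.
  by apply: ler_pM => //; [exact: mulr_ge0|rewrite divr_ge0// ltW].
have BYL : 0 <= B * Y * L by rewrite mulr_ge0// mulr_ge0 ?ltW.
have w0 : 0 <= s - E - V by lra.
have wN : (s - E - V) * N <= B * m * d.
  have -> : (s - E - V) * N = (s - V) * N - E * N by ring.
  have : B * (L * Y + m * d) = B * Y * L + B * m * d by ring.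
  lra.
have l0 : 0 < l by lra.
rewrite ler_pdivrMr ?mulr_gt0//.
have wT : (s - E - V) * T <= 2 * (B * m * d).
  have : (s - E - V) * (T / 2) <= (s - E - V) * N by rewrite ler_wpM2l.
  lra.
have d0 : 0 <= B * m * d.
  apply: le_trans wN; rewrite mulr_ge0//; apply: le_trans TN.
  by rewrite divr_ge0 ?ltW.
apply: le_trans wT _.
have -> : d * (B * l * m) = l * (B * m * d) by ring.
by rewrite ler_wpM2r.
Qed.

End Numerics.

Theorem theorem1p2 (R : realType) :
  exists C A : R, 0 < C /\ 0 < A /\
  forall (lambda f : nat -> R),
    0 <= lambda 1%N ->
    (forall n : nat, (1 <= n)%N -> lambda n < lambda n.+1) ->
    (forall n : nat, (1 <= n)%N -> 0 <= f n) ->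
    cvgn (fun N : nat => \sum_(1 <= n < N) f n) ->
  forall (M : nat) (calM : {fset nat}) (Y T : R),
    (1 <= M)%N ->
    (forall m : nat, m \in calM -> (1 <= m)%N) ->
    #|` calM|%fset = M ->
    1 <= Y -> Y < T -> 2 <= T ->
  exists S maxRe maxAbs : R,
    is_max (fun x : R => complex.Re (expsum lambda f x)) `[Y, T] maxRe /\
    is_max (fun x : R => cabs (expsum lambda f x)) `[Y, T] maxAbs /\
    `|S - 2 * C * \sum_(m <- calM) f m|
      <= A * (2 ^+ M * Y * ln T / T) * sum_from1 f /\
    S <= maxRe /\
    (0 < S ->
     forall V : R, 0 < V -> V <= S ->
       (((S - V) * T / (2 ^+ M * ln T * maxAbs))%:E
        <= lebesgue_measure
             [set x : R | x \in `[Y, T] /\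
                (V <= complex.Re (expsum lambda f x))%R])%E).
Proof.
have ln2_gt0 : 0 < ln 2 :> R by rewrite ln_gt0// ltr1n.
(* The summand 4 serves the two bounds above, expR 2 the inequality T >= e^2. *)
pose a : R := (4 + expR 2) / ln 2.
have a0 : 0 < a by rewrite divr_gt0// addr_gt0// expR_gt0.
exists (4^-1 : R), a; split; first by rewrite invr_gt0.
split => // lambda f _ _ f0 cf M A Y T M1 A1 cardA Y1 YT T2.
have Y0 : 0 < Y by apply: lt_le_trans Y1.
have T0 : 0 < T by apply: lt_trans YT.
have [maxRe maxReP] :=
  continuous_is_max _ _ _ _ (ltW YT) (Re_expsum_continuous lambda _ f0 cf).
have [maxAbs maxAbsP] :=
  continuous_is_max _ _ _ _ (ltW YT) (cabs_expsum_continuous lambda _ f0 cf).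
have L0 := sum_from1_ge0 _ f0 cf.
have sL := sum_fset_le_sum_from1 _ A f0 cf A1.
set L := sum_from1 f in L0 sL *.
set s := \sum_(m <- A) f m in sL *.
have B0 : 0 < 2 ^+ M :> R by rewrite exprn_gt0.
have B1 : 1 <= 2 ^+ M :> R by rewrite exprn_ege1// ler1n.
have lnT : ln 2 <= ln T by rewrite ler_ln ?posrE.
have lnT0 : 0 < ln T by apply: lt_le_trans lnT.
have alnT : 4 + expR 2 <= a * ln T.
  by rewrite -[leLHS](divfK (lt0r_neq0 ln2_gt0)) ler_wpM2l// ltW.
have a4 : 4 <= a * ln T by apply: le_trans alnT; rewrite lerDl expR_ge0.
have mass := kernel_mass_ge lambda A _ T0.
pose S := 2^-1 * s - a * ln T * (2 ^+ M * Y / T) * L.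
have SM : S <= maxRe.
  apply: (max_ge_of_mass _ _ _ _ _ _ _ _ L0 B0 Y0 T0 mass a4).
  by have := le_max_Re_expsum lambda f A f0 cf A1 _ _ _ Y1 YT maxReP; rewrite cardA.
exists S, maxRe, maxAbs; split => //; split => //; split; last split => //.
  have -> : S - 2 * 4^-1 * s = - (a * (2 ^+ M * Y * ln T / T) * L).
    by rewrite /S; field; rewrite gt_eqF.
  by rewrite normrN ger0_norm// mulr_ge0// mulr_ge0 ?ltW// !mulr_gt0// invr_gt0.
move=> S0 V V0 VS.
have maxAbs0 : 0 < maxAbs.
  have [[x xYT Fx] _] := maxReP; have [_ mub] := maxAbsP.
  apply: lt_le_trans S0 (le_trans SM _); rewrite -Fx.
  exact: le_trans (Re_le_cabs _) (mub _ (ex_intro2 _ _ x xYT erefl)).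
(* Positivity of S makes the error term, at least (a ln T / T) L, smaller than
   s / 2 <= L / 2; as a ln T >= expR 2, this fails for T < expR 2. *)
have lnT2 : 2 <= ln T.
  rewrite -[leLHS]expRK ler_ln ?posrE ?expR_gt0//.
  rewrite leNgt; apply/negP => TE.
  have : 1 * L <= a * ln T * (2 ^+ M * Y / T) * L.
    rewrite ler_wpM2r// mulrA ler_pdivlMr// mul1r.
    apply: le_trans (ltW TE) _; apply: le_trans (_ : a * ln T <= _).
      by apply: le_trans alnT; rewrite lerDr.
    by rewrite ler_peMr ?mulr_ege1// mulr_ge0 ?ltW.
  by move: S0; rewrite /S mul1r; lra.
have [d -> dP] := le_measure_Re_expsum lambda f A f0 cf A1 _ _ _ _ Y1 YT V0
  (ltW maxAbs0) maxAbsP.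
rewrite lee_fin.
apply: (measure_ge_of_mass _ _ _ _ _ _ _ _ _ _ _ L0 B0 Y0 T0 mass a4) => //.
by rewrite cardA in dP.
Qed.
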